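(* Let $G$ be a finite group such that the clique number of the difference subgroup graph satisfies $\omega(D(G))\leq 4$. Then $G$ is supersolvable.
   Context: For a finite group $G$, the difference subgroup graph $D(G)$ is the undirected graph whose vertices are the non-trivial proper subgroups of $G$, with two distinct vertices $H$ and $K$ adjacent if and only if $\langle H,K\rangle = G$ and $HK\neq G$, where $HK=\{hk : h\in H,\ k\in K\}$. The clique number $\omega(D(G))$ is the size of a largest complete subgraph of $D(G)$. *)

(* Defs.v *)
From HB Require Import structures.
From mathcomp Require Import all_boot all_fingroup all_solvable.

Set Implicit Arguments.
Unset Strict Implicit.
Unset Printing Implicit Defensive.

Local Open Scope group_scope.

Section Clique.

Variable T : finType.
Implicit Types (V C : {set T}) (e : rel T).

(* The graph has vertex set V and edge relation e restricted to V. *)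
Definition is_clique V e C :=
  (C \subset V) && [forall x in C, forall y in C, (x != y) ==> e x y].

Definition clique_number V e : nat := \max_(C | is_clique V e C) #|C|.

End Clique.

Section DifferenceSubgroupGraph.

Variable gT : finGroupType.
Implicit Types G H K : {group gT}.

Definition dsg_vertices G : {set {group gT}} :=
  [set H : {group gT} | (H :!=: 1) && (H \proper G)].

(* H <*> K is the generated subgroup <H, K>, H * K the product set HK. *)
Definition dsg_edge G : rel {group gT} :=
  [rel H K : {group gT} | [&& H != K, H <*> K == G & H * K != G]].

Definition dsg_clique_number G : nat :=
  clique_number (dsg_vertices G) (dsg_edge G).

End DifferenceSubgroupGraph.

Section Supersolvable.

Variable gT : finGroupType.

Definition cyclic_invariant_factor (A V U : {set gT}) : bool :=
  invariant_factor A V U && cyclic (U / V).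

(* There is a series 1 = G_0 <= ... <= G_n = G with every G_i normal in G and
   every G_(i+1) / G_i cyclic. The series is increasing and ends at G, so terms
   normalised by G are automatically normal subgroups of G. *)
Definition supersolvable (G : {group gT}) : Prop :=
  exists s : seq {group gT},
    (cyclic_invariant_factor G).-series 1%G s /\ last 1%G s = G.

End Supersolvable.

(* Main.v *)
(* The conjugates of a non-normal maximal subgroup M form a clique of size
   |G : M|, since M M^x <> G for every x. If |G : M| = 4, some element lies in
   no conjugate of M; it or its square generates a subgroup that is not
   transitive on G / M, which extends the clique to size 5. Hence
   omega(D(G)) <= 4 makes every maximal subgroup normal or of index 3, so M
   meets H = <x^2 : x in G> in a normal subgroup of G. By the Frattini argument
   H is then nilpotent. A minimal normal subgroup N is central in G or lies in
   Z(H); in the latter case each x in G has x^2 centralising N, so x centralises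
   or inverts N, and N is cyclic. As this also applies to the quotients of G,
   all chief factors of G are cyclic. *)
Require Import Defs.
From mathcomp Require Import all_boot all_fingroup all_solvable.

Set Implicit Arguments.
Unset Strict Implicit.
Unset Printing Implicit Defensive.

Local Open Scope group_scope.

(** * Nilpotent normal subgroups and cyclic chief factors *)

Section NilpotentNormal.

Variable gT : finGroupType.
Implicit Types G H M N : {group gT}.

(** If a Sylow subgroup [P] of [H] were not normal in [G], some maximal [M] would contain ['N_G(P)],
    and [P] would be Sylow in [M :&: H]. The Frattini argument would give [G = (M :&: H) * 'N_G(P)],
    inside [M]. So every Sylow subgroup of [H] lies in ['F(H)]. *)
Lemma nilpotent_maximalI_normal G H :
    H <| G -> (forall M, maximal M G -> M :&: H <| G) -> nilpotent H.
Proof.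
move=> nsHG nsMH; have [sHG nHG] := andP nsHG.
suffices sHF: H \subset 'F(H) by exact: nilpotentS sHF (Fitting_nil H).
rewrite -{1}(Sylow_gen H) gen_subG; apply/bigcupsP=> P /SylowP[p _ sylP].
have sPH := pHall_sub sylP; have pP := pHall_pgroup sylP.
suffices nPG: G \subset 'N(P).
  by rewrite Fitting_max ?(pgroup_nil pP) // /normal sPH (subset_trans sHG).
have [<- | [M maxM sNM]] := maximal_exists (subsetIl G 'N(P)).
  exact: subsetIr.
have [/andP[sMG ltMG] _] := maxgroupP maxM.
have sPM: P \subset M.
  by rewrite (subset_trans _ sNM) // subsetI normG (subset_trans sPH).
have sylPMH: p.-Sylow(M :&: H) P.
  by rewrite (pHall_subl _ (subsetIr M H) sylP) // subsetI sPM.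
case/negP: ltMG; rewrite -{1}(Frattini_arg (nsMH M maxM) sylPMH).
by rewrite mul_subG ?subsetIl.
Qed.

Lemma minnormal_cycle G N n :
    minnormal N G -> n \in N -> n != 1 ->
  {in G, forall x, n ^ x \in <[n]>} -> cyclic N.
Proof.
move=> /mingroupP[_ minN] Nn ntn nnG; apply/cyclicP; exists n.
rewrite [RHS](minN <[n]>%G) ?cycle_subG //= cycle_eq1 ntn /=.
by apply/subsetP=> x /nnG; rewrite -norms_cycle cycle_subG.
Qed.

Lemma minnormal_cyclic G H N :
    H <| G -> nilpotent H -> {in G, forall x, x ^+ 2 \in H} ->
  N \subset G -> minnormal N G -> cyclic N.
Proof.
move=> nsHG nilH sqH sNG minN; have [sHG nHG] := andP nsHG.
have [/andP[ntN nNG] min_N] := mingroupP minN.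
have minN_sub (L : {group gT}) :
    G \subset 'N(L) -> L \subset N -> L :!=: 1 -> N \subset L.
  by move=> nLG sLN ntL; rewrite (min_N L) ?ntL.
(* [G / H] has exponent dividing 2, hence is abelian. *)
have der1H: G^`(1) \subset H.
  apply: der1_min => //; apply: (@abelem_abelian _ 2); apply: exponent2_abelem.
  apply/exponentP=> _ /morphimP[x Nx Gx ->].
  by rewrite -morphX //= coset_id ?sqH.
have [n Nn ntn] := trivgPn _ ntN.
have [tiNH | ntNH] := eqVneq (N :&: H) 1.
  apply: (minnormal_cycle minN Nn ntn) => x Gx.
  (* [[~: N, G]] lies in both [N] and the derived subgroup, hence in [N :&: H]. *)
  have cNG: N \subset 'C(G).
    apply/commG1P/trivgP; rewrite -tiNH subsetI commg_subl nNG.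
    by apply: subset_trans der1H; rewrite commSg.
  by rewrite conjgE (centP (subsetP cNG n Nn) x Gx) mulKg cycle_id.
have sNH: N \subset H.
  by rewrite (subset_trans _ (subsetIr N H)) // minN_sub ?normsI ?subsetIl.
have sNZ: N \subset 'Z(H).
  rewrite (subset_trans _ (subsetIr N _)) //.
  apply: (minN_sub [group of N :&: 'Z(H)]); rewrite ?subsetIl //=.
    by rewrite normsI // (char_norm_trans (center_char H)).
  by rewrite meet_center_nil // /normal sNH (subset_trans sHG).
have cNH h m : h \in H -> m \in N -> commute m h.
  by move=> Hh /(subsetP sNZ)/centerP[_]; apply.
apply: (minnormal_cycle minN Nn ntn) => x Gx.
(* For [g] in [G], [x ^ g] and [x] differ by a commutator, which lies in [H] and so centralises [N].
   By minimality ['C_N[x]] is then trivial or all of [N]. *)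
have nCG: G \subset 'N('C_N[x]).
  apply/subsetP=> g Gg; rewrite inE.
  apply/subsetP=> _ /imsetP[m /setIP[Nm cmx] ->].
  have Nmg: m ^ g \in N by rewrite memJ_norm ?(subsetP nNG).
  rewrite inE Nmg; apply/cent1P.
  have Hxg: [~ x, g]^-1 \in H.
    by rewrite groupV (subsetP der1H) // mem_commg.
  have ->: x = x ^ g * [~ x, g]^-1.
    by rewrite commgEl invMg invgK mulKVg.
  apply: commuteM; last exact: cNH.
  by rewrite /commute -!conjMg (cent1P cmx).
have [C1 | ntC] := eqVneq 'C_N[x] 1.
  have Nnx: n ^ x \in N by rewrite memJ_norm ?(subsetP nNG).
  (* As [x ^+ 2] centralises [n], conjugation by [x] swaps the two commuting factors and fixes the
     product. A trivial centraliser thus forces [n ^ x = n^-1]. *)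
  suffices: n * n ^ x \in 'C_N[x].
    rewrite C1 => /set1P/(canRL (mulKg n)); rewrite mulg1 => ->.
    by rewrite groupV cycle_id.
  rewrite inE groupM //=; apply/cent1P/commgP/conjg_fixP.
  rewrite conjMg -conjgM -expg2 [n ^ (x ^+ 2)]conjgE (cNH _ n (sqH x Gx) Nn).
  by rewrite mulKg; apply: cNH => //; apply: (subsetP sNH).
have sNC := minN_sub _ nCG (subsetIl _ _) ntC.
have /setIP[_ /cent1P cnx] := subsetP sNC n Nn.
by rewrite conjgE cnx mulKg cycle_id.
Qed.

End NilpotentNormal.

(** For a chief factor [U / V], the hypotheses pass to [H / V] in [G / V], where [U / V] is minimal
    normal. *)
Lemma supersolvable_nilpotent_sqr (gT : finGroupType) (G H : {group gT}) :
    H <| G -> nilpotent H -> {in G, forall x, x ^+ 2 \in H} ->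
  supersolvable G.
Proof.
move=> nsHG nilH sqH.
have [s chief_s last_s] := chief_series_exists (normal_refl G).
exists s; split=> //; apply: sub_path chief_s => V U /= chiefVU.
have minUV := chief_factor_minnormal chiefVU.
case/andP: chiefVU => /maxgroupp/andP[/proper_sub sVU nVG] /andP[sUG nUG].
rewrite /cyclic_invariant_factor /invariant_factor.
rewrite nVG nUG /normal sVU (subset_trans sUG) //=.
apply: (minnormal_cyclic (quotient_normal V nsHG) _ _ _ minUV) => /=.
- exact: quotient_nil.
- by move=> _ /morphimP[x Nx Gx ->]; rewrite -morphX // mem_quotient ?sqH.
- exact: quotientS.
Qed.

(** * The subgroup of squares, and the action on cosets of a maximal subgroup *)

Section MaximalConjugates.

Variable gT : finGroupType.
Implicit Types G H K L M X : {group gT}.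

(** The smallest normal subgroup of [G] whose quotient is an elementary abelian 2-group. *)
Definition sqr_subgroup G := <<[set x ^+ 2 | x in G]>>.

Canonical sqr_subgroup_group G := Eval hnf in [group of sqr_subgroup G].

Lemma sqr_subgroup_normal G : sqr_subgroup G <| G.
Proof.
rewrite /normal gen_subG; apply/andP; split.
  by apply/subsetP=> _ /imsetP[x Gx ->]; rewrite groupX.
rewrite norms_gen //; apply/subsetP=> g Gg; rewrite inE.
apply/subsetP=> _ /imsetP[_ /imsetP[x Gx ->] ->].
by rewrite conjXg (imset_f (fun y => y ^+ 2)) ?groupJ.
Qed.

Lemma sqr_subgroup_sub_index2 G L :
  L \subset G -> #|G : L| = 2 -> sqr_subgroup G \subset L.
Proof.
move=> sLG iL; have [_ nLG] := andP (index2_normal sLG iL).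
rewrite gen_subG; apply/subsetP=> _ /imsetP[x Gx ->].
have Nx := subsetP nLG x Gx; apply: coset_idr; first exact: groupX.
by rewrite morphX // -iL -card_quotient // expg_cardG ?mem_quotient.
Qed.

(** Writing [x] itself as [a * b ^ x] with [a], [b] in [M] gives [x = b * a], so [x] is in [M] and
    the product collapses to [M]. *)
Lemma maximal_mulJ_neq G M x :
  maximal M G -> x \in G -> M * M :^ x != G.
Proof.
move=> /maxgroupp/andP[sMG /negP neqMG] Gx; apply/eqP=> defG.
have: x \in M * M :^ x by rewrite defG.
case/mulsgP=> a _ Ma /imsetP[b Mb ->]; rewrite conjgE !mulgA => defx.
apply: neqMG; rewrite -defG conjGid ?mulGid //.
suffices ->: x = b * a by rewrite groupM.
have e: a * x^-1 * b = 1 by apply: (mulIg x); rewrite mul1g -defx.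
by rewrite (canRL (mulKg _) e) mulg1 invMg invgK mulgKV.
Qed.

Lemma maximal_joing G M L :
  maximal M G -> L \subset G -> ~~ (L \subset M) -> M <*> L = G.
Proof.
move=> /maxgroupP[/proper_sub sMG maxM] sLG not_sLM; apply/eqP.
rewrite eqEproper join_subG sMG sLG /=; apply: contra not_sLM => ltMLG.
by rewrite -(maxM [group of M <*> L]) ?joing_subr ?joing_subl.
Qed.

Lemma maximal_normalizer G M : maximal M G -> ~~ (M <| G) -> 'N_G(M) = M.
Proof.
move=> /maxgroupP[/proper_sub sMG maxM]; rewrite /normal sMG /= => nM.
apply: maxM; last by rewrite subsetI sMG normG.
by rewrite properE subsetIl /= subsetI subxx.
Qed.

Lemma maximal_index3_normalI G M :
  maximal M G -> #|G : M| = 3 -> M :&: sqr_subgroup G <| G.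
Proof.
move=> maxM iM; have [nsMG | ] := boolP (M <| G).
  by rewrite normalI ?sqr_subgroup_normal.
have [/andP[sMG _] _] := maxgroupP maxM.
rewrite /normal sMG => /subsetPn[x Gx nMx].
have sMxG: M :^ x \subset G by rewrite -(conjGid Gx) conjSg.
have not_sMxM: ~~ (M :^ x \subset M).
  apply: contra nMx => sMxM.
  by apply/normP/eqP; rewrite eqEcard sMxM cardJg leqnn.
(* K has index 2 in both M and M^x, hence is normal in G = <M, M^x> with
   |G / K| = 6; squares land in the Sylow 3-subgroup T of G / K, which meets
   M / K trivially. *)
pose K := [group of M :&: M :^ x].
have sKM: K \subset M := subsetIl _ _.
have sKMx: K \subset M :^ x := subsetIr _ _.
(* The product set has [#|M| * #|M :^ x : K|] elements, fewer than [#|G| = #|M| * 3], so the index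
   is below 3; it is not 1 because [M :^ x] is not inside [M]. *)
have iMxK: #|M :^ x : K| = 2.
  have ltMMx: (#|(M * M :^ x)%g| < #|M| * 3)%N.
    rewrite -iM Lagrange // proper_card // properEneq maximal_mulJ_neq //.
    by rewrite mul_subG.
  move: ltMMx; rewrite -LagrangeMl ltn_pmul2l // /K /= setIC indexgI.
  move: not_sMxM; rewrite -indexg_eq1; have := indexg_gt0 (M :^ x) M.
  by case: #|_ : _| => [|[|[|]]].
have iMK: #|M : K| = 2 by rewrite -iMxK -!divgS // cardJg.
have iGK: #|G : K| = 6 by rewrite -(Lagrange_index sMG sKM) iM iMK.
have nKG: G \subset 'N(K).
  rewrite -(maximal_joing maxM sMxG not_sMxM) join_subG.
  by rewrite !normal_norm ?index2_normal.
have nKM := subset_trans sMG nKG.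
have [T sylT] := Sylow_exists 3 (G / K)%G.
have sTG := pHall_sub sylT.
have cardT: #|T| = 3 by rewrite (card_Hall sylT) card_quotient // iGK p_part.
have iT: #|G / K : T| = 2.
  by rewrite -divgS // cardT card_quotient // iGK.
have nsKG: K <| G by rewrite /normal (subset_trans sKM).
pose L := [group of coset K @*^-1 T].
have sLG: L \subset G by rewrite -(quotientGK nsKG) morphpreS.
have sHL: sqr_subgroup G \subset L.
  apply: sqr_subgroup_sub_index2 => //.
  by rewrite -[in LHS](quotientGK nsKG) index_cosetpre.
suffices sMHK: M :&: sqr_subgroup G \subset K.
  suffices ->: M :&: sqr_subgroup G = K :&: sqr_subgroup G.
    exact: normalI nsKG (sqr_subgroup_normal G).
  by apply/eqP; rewrite eqEsubset subsetI sMHK subsetIr setSI.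
rewrite -quotient_sub1 ?(subset_trans (subsetIl _ _)) //.
have tiMT: M / K :&: T = 1.
  by apply: coprime_TIg; rewrite cardT card_quotient // iMK.
rewrite -tiMT subsetI quotientS ?subsetIl //=.
apply: subset_trans (quotientS K (subset_trans (subsetIr M _) sHL)) _.
by rewrite /= cosetpreK.
Qed.

(** Jordan's count: at most [#|G : M|] conjugates, with [#|M| - 1] nontrivial elements each, cover
    at most [#|G| - #|G : M|] nontrivial elements. Covering all [#|G| - 1] would force [M = G]. *)
Lemma class_support_proper G M :
  M \proper G -> exists2 x, x \in G & x \notin class_support M G.
Proof.
move=> ltMG; have sMG := proper_sub ltMG.
suffices /subsetPn[x Gx nx]: ~~ (G \subset class_support M G) by exists x.
apply: contraL ltMG => sGC; rewrite properE sMG negbK /=.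
have: (#|G^#| <= #|G : M| * #|M^#|)%N.
  apply: leq_trans (subset_leq_card (setSD _ sGC)) _.
  rewrite class_supportD1; apply: leq_trans (leq_card_cover _) _.
  rewrite (eq_bigr (fun=> #|M^#|)) => [|_ /imsetP[x _ ->]]; last first.
    by rewrite cardJg.
  rewrite sum_nat_const card_conjugates leq_mul // dvdn_leq ?indexgS //.
  by rewrite /= normD1 subsetI sMG normG.
have := Lagrange sMG; rewrite (cardsD1 1 G) (cardsD1 1 M) !group1 !add1n mulSn.
move=> defG; rewrite -ltnS -defG mulnC -add1n leq_add2r => iGM.
by rewrite -indexg_eq1 eqn_leq iGM indexg_gt0.
Qed.

(** [X * M = G] means that [X] is transitive on the cosets of [M], which does not depend on the base
    point. Concretely, [g = b * a] with [b] in [M] and [a] in [X], so [M :^ g = M :^ a], and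
    conjugation by [a] preserves [X] and [G]. *)
Lemma mul_conj_neq G X M g :
    X \subset G -> M \subset G -> g \in G -> X * M != G -> X * M :^ g != G.
Proof.
move=> sXG sMG Gg; apply: contra => /eqP defG.
have: g \in X * M :^ g by rewrite defG.
case/mulsgP=> a _ Xa /imsetP[b Mb ->]; rewrite conjgE !mulgA => defg.
have e: a * g^-1 * b = 1 by apply: (mulIg g); rewrite mul1g -defg.
have gE: g = b * a by rewrite (canRL (mulKg _) e) mulg1 invMg invgK mulgKV.
have Ga := subsetP sXG a Xa.
rewrite -(inj_eq (@conjsg_inj _ a)) conjsMg (conjGid Xa) (conjGid Ga).
by rewrite -{1}(conjGid Mb) -conjsgM -gE defG.
Qed.

(** If [<[x]> :&: L] has order [m], then [x] has order [4m] and [x ^+ 2] has order [2m], too large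
    for [L]. The subgroup of order [m] of the cyclic group [<[x]>] lies in [<[x ^+ 2]>], so the
    second index is at most 2. *)
Lemma cycle_index4_sqr x L :
  #|<[x]> : L| = 4 -> x ^+ 2 \notin L /\ #|<[x ^+ 2]> : L| != 4.
Proof.
move=> ixL; have := LagrangeI <[x]> L; rewrite ixL -orderE.
set m := #|_ :&: _| => ox.
have m_gt0: (0 < m)%N by apply: cardG_gt0.
have ox2: #[x ^+ 2] = (m * 2)%N.
  by rewrite orderXdiv -ox ?dvdn_mull // -[4]/(2 * 2)%N mulnA mulnK.
have sx2x: <[x ^+ 2]> \subset <[x]> by rewrite cycleX.
split.
  apply/negP=> Lx2; have: (#[x ^+ 2] <= m)%N.
    by rewrite subset_leq_card // subsetI sx2x cycle_subG.
  by rewrite ox2 -[X in (_ <= X)%N]muln1 leq_pmul2l.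
apply/eqP=> ix2L; have := LagrangeI <[x ^+ 2]> L.
rewrite ix2L -orderE ox2 => ox2L.
have: (m <= #|<[x ^+ 2]> :&: L|)%N.
  rewrite subset_leq_card // subsetI subsetIr andbT.
  rewrite -(cardSg_cyclic (cycle_cyclic x)) ?subsetIl //.
  by rewrite -orderE ox2 dvdn_mulr.
rewrite -(leq_pmul2r (isT : 0 < 4)%N) ox2L -[4]/(2 * 2)%N mulnA.
by rewrite -[X in (_ <= X)%N]muln1 leq_pmul2l ?muln_gt0 ?m_gt0.
Qed.

(** [#|X : M|] is the length of the orbit of [X] through the coset [M]; transitivity means that it
    equals the degree [#|G : M|]. *)
Lemma mulG_eq_index G X M : M \subset G -> X \subset G ->
  (X * M == G) = (#|X : M| == #|G : M|).
Proof.
move=> sMG sXG; have sXMG: X * M \subset G by rewrite mul_subG.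
have -> : (X * M == G) = (#|(X * M)%g| == #|G|).
  by rewrite eqEcard sXMG eqn_leq (subset_leq_card sXMG).
by rewrite -LagrangeMr -(Lagrange sMG) mulnC eqn_pmul2l.
Qed.

(** An element outside all conjugates of [M] fixes no coset of [M]. If it generates a transitive
    group, it acts as a 4-cycle, and its square, a product of two disjoint transpositions, still
    fixes no coset but is not transitive. *)
Lemma exists_nontransitive_derangement G M :
    M \proper G -> #|G : M| = 4 ->
  exists x, [/\ x \in G, x \notin class_support M G & <[x]> * M != G].
Proof.
move=> ltMG iM; have [sMG _] := andP ltMG.
have [x Gx nMx] := class_support_proper ltMG.
have [defG|] := eqVneq (<[x]> * M) G; last by exists x.
have sxG: <[x]> \subset G by rewrite cycle_subG.
(* Transitivity passes to every conjugate of [M]: this shows that [x ^+ 2] avoids all of them, and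
   [g = 1] gives its non-transitivity. *)
have index_x g : g \in G -> #|<[x]> : M :^ g| = 4.
  move=> Gg; have sMgG: M :^ g \subset G by rewrite conj_subG.
  have /eqP: <[x]> * M :^ g == G.
    apply/idPn=> /(mul_conj_neq sxG sMgG (groupVr Gg)).
    by rewrite conjsgK defG eqxx.
  move/eqP; rewrite mulG_eq_index // => /eqP->.
  by rewrite -iM -{1}(conjGid Gg) indexJg.
exists (x ^+ 2); split; first exact: groupX.
  apply/negP; rewrite class_supportEr => /bigcupP[g /index_x ixMg].
  by have [/negP] := cycle_index4_sqr ixMg.
rewrite mulG_eq_index ?cycle_subG ?groupX // iM.
by have [] := cycle_index4_sqr (index_x 1 (group1 G)); rewrite /= conjsg1.
Qed.

End MaximalConjugates.

(** * Cliques built from the conjugates of a maximal subgroup *)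

Section Cliques.

Variable gT : finGroupType.
Implicit Types G H K M X : {group gT}.

Lemma maximal_nonnormal_vertex G M :
  maximal M G -> ~~ (M <| G) -> M \in dsg_vertices G.
Proof.
move=> /maxgroupp ltMG; rewrite inE ltMG andbT; apply: contra => /eqP->.
exact: normal1.
Qed.

Lemma mem_conjugates_maximal G M L :
  maximal M G -> L \in orbit 'JG G M ->
  maximal L G /\ exists2 x, x \in G & L :=: M :^ x.
Proof.
move=> maxM /imsetP[x Gx ->] /=; split; last by exists x.
by rewrite -(conjGid Gx) maximalJ.
Qed.

(** Distinct conjugates have equal order, so neither contains the other and maximality makes them
    generate [G]; each is a conjugate of the other, so their product is not [G]. *)
Lemma dsg_edge_conjugates G M :
    maximal M G ->
  {in orbit 'JG G M &, forall K L, K != L -> dsg_edge G K L}.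
Proof.
move=> maxM K L /(mem_conjugates_maximal maxM)[maxK [x Gx defK]].
move=> /(mem_conjugates_maximal maxM)[maxL [y Gy defL]] neqKL.
have defLK: L :=: K :^ (x^-1 * y) by rewrite defK conjsgM conjsgK.
rewrite /dsg_edge /= neqKL [L in _ * L]defLK.
rewrite maximal_mulJ_neq ?groupM ?groupV // andbT.
have [/proper_sub sLG _] := maxgroupP maxL.
rewrite (maximal_joing maxK) ?eqxx //; apply: contra neqKL => sLK.
by rewrite eq_sym -val_eqE /= eqEcard sLK defK defL !cardJg leqnn.
Qed.

Lemma card_conjugates_maximal G M :
  maximal M G -> ~~ (M <| G) -> #|orbit 'JG G M| = #|G : M|.
Proof. by move=> maxM nM; rewrite card_orbit astab1JG maximal_normalizer. Qed.

Lemma conjugates_is_clique G M :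
    maximal M G -> ~~ (M <| G) ->
  is_clique (dsg_vertices G) (dsg_edge G) (orbit 'JG G M).
Proof.
move=> maxM nM; apply/andP; split.
  apply/subsetP=> L oL.
  have [maxL [x Gx defL]] := mem_conjugates_maximal maxM oL.
  by rewrite maximal_nonnormal_vertex // defL -(conjGid Gx) normalJ.
do 2!apply/forall_inP=> ? ?; apply/implyP.
exact: dsg_edge_conjugates maxM _ _ _ _.
Qed.

Lemma clique_number_max (T : finType) (V C : {set T}) (e : rel T) :
  is_clique V e C -> (#|C| <= clique_number V e)%N.
Proof. exact: leq_bigmax_cond. Qed.

Lemma dsg_edge_sym G : symmetric (dsg_edge G).
Proof.
move=> K L; rewrite /dsg_edge /= eq_sym joingC; congr [&& _, _ & ~~ _].
by rewrite -[K * L == G](inj_eq invg_inj) invMg !invGid.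
Qed.

(** [X] escapes the maximal subgroup [L], so they generate [G]; the product condition transfers from
    [M] to its conjugate [L]. *)
Lemma derangement_edge G M X L :
    maximal M G -> L \in orbit 'JG G M -> X \subset G -> X * M != G ->
    ~~ (X \subset L) -> dsg_edge G L X.
Proof.
move=> maxM oL sXG neqXM nsXL.
have [maxL [g Gg defL]] := mem_conjugates_maximal maxM oL.
have [/proper_sub sMG _] := maxgroupP maxM.
rewrite dsg_edge_sym /dsg_edge /= joingC (maximal_joing maxL) // eqxx /=.
rewrite defL mul_conj_neq // andbT; apply: contra nsXL => /eqP->.
exact: subxx.
Qed.

Lemma maximal_normal_or_index3 G M :
    (dsg_clique_number G <= 4)%N -> maximal M G -> M <| G \/ #|G : M| = 3.
Proof.
move=> cl4 maxM; have [|nM] := boolP (M <| G); [by left | right].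
have /andP[sMG not_sGM] := maxgroupp maxM.
have clM := conjugates_is_clique maxM nM.
have := leq_trans (clique_number_max clM) cl4.
(* Index 3 is the goal and indices above 4 break the bound; 0, 1, 2 and 4 remain to be excluded. *)
rewrite card_conjugates_maximal //; case iM: #|_ : _| => [|[|[|[|[|]]]]] // _.
- by have := indexg_gt0 G M; rewrite iM.
- by case/negP: not_sGM; rewrite -indexg_eq1 iM.
- by case/negP: nM; rewrite index2_normal.
have [x [Gx nMx neqxM]] := exists_nontransitive_derangement (maxgroupp maxM) iM.
have sxG: <[x]> \subset G by rewrite cycle_subG.
have nsxL L : L \in orbit 'JG G M -> ~~ (<[x]> \subset L).
  case/(mem_conjugates_maximal maxM)=> _ [g Gg ->]; rewrite cycle_subG.
  by apply: contra nMx => Mgx; rewrite class_supportEr; apply/bigcupP; exists g.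
(* [<[x]>] lies in no conjugate of [M], so it is a fifth vertex. *)
suffices: is_clique (dsg_vertices G) (dsg_edge G) (<[x]>%G |: orbit 'JG G M).
  move/clique_number_max/leq_trans/(_ cl4); rewrite cardsU1.
  by rewrite (contraL (@nsxL _)) ?subxx // card_conjugates_maximal // iM.
have [sMV /forall_inP eM] := andP clM.
have sLx L : L \in orbit 'JG G M -> dsg_edge G L <[x]>%G.
  by move=> oL; apply: derangement_edge maxM oL sxG neqxM (nsxL L oL).
apply/andP; split.
  rewrite subUset sMV andbT sub1set inE cycle_eq1 properE sxG /=.
  apply/andP; split.
    by apply: contra nMx => /eqP->; rewrite mem_class_support.
  apply: contra neqxM => sGx; have /eqP-> : <[x]> == G by rewrite eqEsubset sxG.
  by rewrite mulGSid.
apply/forall_inP=> K /setU1P[-> | oK]; apply/forall_inP=> L /setU1P[-> | oL].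
- by rewrite eqxx.
- by rewrite dsg_edge_sym sLx ?implybT.
- by rewrite sLx ?implybT.
by have /forall_inP := eM K oK; apply.
Qed.

End Cliques.

Theorem theorem6p1 (gT : finGroupType) (G : {group gT})
  (clique_le4 : (dsg_clique_number G <= 4)%N) :
  supersolvable G.
Proof.
apply: (@supersolvable_nilpotent_sqr _ _ (sqr_subgroup_group G)).
- exact: sqr_subgroup_normal.
- apply: nilpotent_maximalI_normal (sqr_subgroup_normal G) _ => M maxM.
  have [nsMG | iM] := maximal_normal_or_index3 clique_le4 maxM.
    exact: normalI nsMG (sqr_subgroup_normal G).
  exact: maximal_index3_normalI.
- by move=> x Gx; rewrite mem_gen ?(imset_f (fun y => y ^+ 2)).
Qed.
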